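(* Consider the following assertion for an odd positive integer $n$: ''for every linear threshold function $f:\{-1,1\}^n\to\{-1,1\}$ and every $\rho\in[0,1]$, $\mathrm{Stab}_\rho(f)\ge \mathrm{Stab}_\rho(\mathrm{Maj}_n)$.'' This assertion is true for $n=1$ and $n=3$, and it is false for every odd $n\ge 5$.
   Context: $\mathrm{sgn}(z)=1$ if $z\ge 0$ and $\mathrm{sgn}(z)=-1$ if $z<0$. A function $f:\{-1,1\}^n\to\{-1,1\}$ is a linear threshold function (LTF) if there are real constants $w_0,\dots,w_n$ with $f(\mathbf{x})=\mathrm{sgn}(w_0+w_1x_1+\cdots+w_nx_n)$ for all $\mathbf{x}\in\{-1,1\}^n$. For odd $n$, $\mathrm{Maj}_n(\mathbf{x})=\mathrm{sgn}(x_1+\cdots+x_n)$. For $\rho\in[0,1]$ and $\mathbf{x}\in\{-1,1\}^n$, $\mathbf{y}\sim N_\rho(\mathbf{x})$ means that independently for each $i$, $y_i=x_i$ with probability $\rho$ and $y_i=\pm1$ with probability $(1-\rho)/2$ each. The noise stability is $\mathrm{Stab}_\rho(f)=\mathbb{E}_{\mathbf{x}\sim\{-1,1\}^n\text{ uniform},\ \mathbf{y}\sim N_\rho(\mathbf{x})}[f(\mathbf{x})f(\mathbf{y})]$. *)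

(* Defs.v *)
From HB Require Import structures.
From mathcomp Require Import all_boot all_order all_algebra.
From mathcomp Require Import reals.

Set Implicit Arguments.
Unset Strict Implicit.
Unset Printing Implicit Defensive.

Import Order.TTheory GRing.Theory Num.Theory.
Local Open Scope ring_scope.

(* The two-element set {-1, 1} is encoded by [bool]: [true] stands for 1 and
   [false] for -1; [pm R] is the inclusion of {-1, 1} into R. *)
Definition pm (R : realType) (b : bool) : R := if b then 1 else -1.

Definition cube (n : nat) : finType := {ffun 'I_n -> bool}.

(* sgn z = 1 if z >= 0 and -1 if z < 0, so sgn 0 = 1 (unlike [Num.sg]). *)
Definition sgn (R : realType) (z : R) : bool := 0 <= z.

Definition is_LTF (R : realType) (n : nat) (f : cube n -> bool) : Prop :=
  exists (w0 : R) (w : 'I_n -> R),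
    forall x : cube n, f x = sgn (w0 + \sum_(i < n) w i * pm R (x i)).

Definition Maj (R : realType) (n : nat) (x : cube n) : bool :=
  sgn (\sum_(i < n) pm R (x i)).

(* Probability that y ~ N_rho(x) takes the value y.  The coordinates are
   independent; each one is kept with probability rho, and otherwise takes each
   of the values 1 and -1 with probability (1 - rho) / 2, so that the two events
   leading to y_i = x_i add up. *)
Definition noise (R : realType) (n : nat) (rho : R) (x y : cube n) : R :=
  \prod_(i < n) (rho * (y i == x i)%:R + (1 - rho) / 2).

Definition Stab (R : realType) (n : nat) (rho : R) (f : cube n -> bool) : R :=
  \sum_(x : cube n) (2 ^+ n)^-1 *
    \sum_(y : cube n) noise rho x y * (pm R (f x) * pm R (f y)).

Definition Maj_least_stable (R : realType) (n : nat) : Prop :=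
  forall f : cube n -> bool, is_LTF R f ->
  forall rho : R, 0 <= rho <= 1 -> Stab rho (@Maj R n) <= Stab rho f.

(* Main.v *)
Require Import Defs.
From HB Require Import structures.
From mathcomp Require Import all_boot all_order all_algebra.
From mathcomp Require Import reals perm.
From mathcomp Require Import zify ring lra.

Set Implicit Arguments.
Unset Strict Implicit.
Unset Printing Implicit Defensive.

Import Order.TTheory GRing.Theory Num.Theory.
Local Open Scope ring_scope.

(* Writing Stab_rho f as the sum over S of rho^|S| f^(S)^2, only the Fourier
   weight of degree at most 1 matters. For odd n <= 3, Parseval's identity and
   the vanishing of the even coefficients of Maj_n reduce the claim to comparing
   these weights; for n = 3 this is checked on the sign patterns obeying the
   linear relations x + y = x' + y' between vertices of the cube. For odd n >=
   5, let f be the majority of m = n - 3 bits, ties being broken by the majority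
   of the other three. With p_k the probability that k uniform signs sum to 0, f
   has degree-1 weight p_m^2 (m + 3/4), against p_(m+2)^2 (m + 3) for Maj_n, and
   since p_(m+2) = p_m (m + 1) / (m + 2) the former is smaller by p_m^2 m^2 / (4
   (m + 2)^2). As f is odd, the inequality fails for small rho > 0. *)

(** * Fourier expansion on the cube and noise stability *)

Definition chi (R : realType) n (S : {set 'I_n}) (x : cube n) : R :=
  \prod_(i in S) pm R (x i).

Definition fourier (R : realType) n (f : cube n -> bool) (S : {set 'I_n}) : R :=
  (2 ^+ n)^-1 * \sum_(x : cube n) pm R (f x) * chi R S x.

Definition cube_cons n (b : bool) (y : cube n) : cube n.+1 :=
  [ffun i => if unlift ord0 i is Some j then y j else b].

Definition cube_neg n (x : cube n) : cube n := [ffun i => ~~ x i].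

Section FourierExpansion.
Variable R : realType.
Implicit Types (n : nat) (rho : R).

Lemma pmN b : pm R (~~ b) = - pm R b.
Proof. by case: b; rewrite /pm //= opprK. Qed.

Lemma pm_sq b : pm R b * pm R b = 1.
Proof. by case: b; rewrite /pm ?mulrNN mulr1. Qed.

(** Each factor of the kernel is (1 + rho x_i y_i) / 2; expanding the product over the coordinates
    gives one term for each subset. *)
Lemma noise_fourier n rho (x y : cube n) :
  noise rho x y =
  (2 ^+ n)^-1 * \sum_(S : {set 'I_n}) rho ^+ #|S| * (chi R S x * chi R S y).
Proof.
rewrite /noise.
have -> : \prod_(i < n) (rho * (y i == x i)%:R + (1 - rho) / 2) =
    \prod_(i < n) (2^-1 * (rho * (pm R (x i) * pm R (y i)) + 1)).
  by apply: eq_bigr => i _; case: (x i); case: (y i); rewrite /pm /=; field.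
rewrite big_split /= prodr_const card_ord exprVn bigA_distr; congr (_ * _).
apply: eq_bigr => S _; rewrite /chi -big_split /= -prodr_const -big_split /=.
rewrite (bigID (mem S)) /= [X in _ * X]big1 ?mulr1.
  by apply: eq_bigr => i ->.
by move=> i /negbTE ->.
Qed.

Lemma Stab_fourier n rho (f : cube n -> bool) :
  Stab rho f = \sum_(S : {set 'I_n}) rho ^+ #|S| * fourier R f S ^+ 2.
Proof.
rewrite /Stab -mulr_sumr.
under eq_bigr => x _.
  under eq_bigr => y _ do rewrite noise_fourier -mulrA mulr_suml.
  rewrite -mulr_sumr exchange_big /=.
  over.
rewrite -mulr_sumr exchange_big /= !mulr_sumr; apply: eq_bigr => S _.
rewrite /fourier; set A := (X in _ * (_ * X) ^+ 2).
suff -> : \sum_(x : cube n) \sum_(y : cube n)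
    rho ^+ #|S| * (chi R S x * chi R S y) * (pm R (f x) * pm R (f y)) =
    rho ^+ #|S| * (A * A) by ring.
rewrite mulr_suml mulr_sumr; apply: eq_bigr => x _.
by rewrite !mulr_sumr; apply: eq_bigr => y _; ring.
Qed.

Lemma sum_cube_recl n (F : cube n.+1 -> R) :
  \sum_x F x = \sum_y F (cube_cons true y) + \sum_y F (cube_cons false y).
Proof.
pose h (p : bool * cube n) := cube_cons p.1 p.2.
have hK : bijective h.
  exists (fun x : cube n.+1 => (x ord0, [ffun j => x (lift ord0 j)])).
    move=> [b y]; rewrite /h /cube_cons ffunE unlift_none; congr pair.
    by apply/ffunP=> j; rewrite !ffunE liftK.
  move=> x; apply/ffunP=> i; rewrite !ffunE /=.
  by case: unliftP => [j ->|->] //; rewrite ffunE.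
rewrite (reindex h) /=; last exact: onW_bij.
by rewrite -(pair_bigA _ (fun b y => F (cube_cons b y))) /= big_bool.
Qed.

(** At rho = 1 the kernel is the indicator of y = x. Evaluating the Fourier formula there yields
    [parseval]. *)
Lemma Stab1 n (f : cube n -> bool) : Stab 1 f = 1 :> R.
Proof.
have inner (x : cube n) :
    \sum_y noise 1 x y * (pm R (f x) * pm R (f y)) = 1.
  rewrite (bigD1 x) //= big1 => [|y nyx].
    rewrite pm_sq /noise big1 => [|i _]; first by rewrite mulr1 addr0.
    by rewrite eqxx subrr mul0r addr0 mulr1.
  suff /existsP [i nyxi] : [exists i, y i != x i].
    by rewrite /noise (bigD1 i) //= (negbTE nyxi) subrr mulr0 mul0r
      addr0 !mul0r.
  rewrite -negb_forall; apply: contra nyx => /forallP e.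
  by apply/eqP/ffunP=> i; apply/eqP.
rewrite /Stab -mulr_sumr (eq_bigr (fun=> 1)) // sumr_const.
rewrite card_ffun card_bool card_ord natrX mulVf //.
by rewrite expf_eq0 pnatr_eq0 andbF.
Qed.

(** The substitution x -> -x fixes the character of an even set and changes the sign of f, so the
    sum is its own opposite. *)
Lemma fourier_odd n (f : cube n -> bool) (S : {set 'I_n}) :
  (forall x, f (cube_neg x) = ~~ f x) -> ~~ odd #|S| -> fourier R f S = 0.
Proof.
move=> fN evS; rewrite /fourier; apply/eqP; rewrite mulf_eq0; apply/orP; right.
have negK : involutive (@cube_neg n).
  by move=> x; apply/ffunP=> i; rewrite !ffunE negbK.
have chiN x : chi R S (cube_neg x) = chi R S x.
  rewrite /chi (eq_bigr (fun i => -1 * pm R (x i))) => [|i _].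
    by rewrite big_split /= prodr_const -signr_odd (negbTE evS) mul1r.
  by rewrite ffunE pmN mulN1r.
set T := \sum_x _; suff : T = - T by move=> e; apply/eqP; lra.
rewrite {1}/T (reindex_inj (inv_inj negK)) -sumrN; apply: eq_bigr => x _.
by rewrite chiN fN pmN mulNr.
Qed.

Lemma fourier_perm n (f : cube n -> bool) (i j : 'I_n) :
  (forall x : cube n, f [ffun k => x (tperm i j k)] = f x) ->
  fourier R f [set i] = fourier R f [set j].
Proof.
move=> fs; rewrite /fourier; congr (_ * _).
have hK : involutive (fun x : cube n => [ffun k => x (tperm i j k)] : cube n).
  by move=> x; apply/ffunP=> k; rewrite !ffunE tpermK.
rewrite (reindex_inj (inv_inj hK)); apply: eq_bigr => x _.
by rewrite fs /chi !big_set1 ffunE tpermL.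
Qed.

Lemma sum_sets_card_le1 n (G : {set 'I_n} -> R) :
  \sum_S G S = G set0 + \sum_i G [set i] +
    \sum_(S : {set 'I_n} | (2 <= #|S|)%N) G S.
Proof.
rewrite (bigD1 set0) //= -addrA; congr (_ + _).
rewrite (bigID (fun S : {set 'I_n} => #|S| == 1%N)) /=; congr (_ + _).
  rewrite -(big_imset (h := set1) G (A := predT)); last exact: in2W set1_inj.
  apply: eq_bigl => S; apply/andP/imsetP => [[_ /cards1P [i ->]]|[i _ ->]].
    by exists i.
  by rewrite cards1 -card_gt0 cards1.
apply: eq_bigl => S; rewrite -card_gt0.
by case: #|S| => [|[|m]].
Qed.

Lemma Stab_split n rho (f : cube n -> bool) :
  Stab rho f = fourier R f set0 ^+ 2 + rho * \sum_i fourier R f [set i] ^+ 2 +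
    \sum_(S : {set 'I_n} | (2 <= #|S|)%N) rho ^+ #|S| * fourier R f S ^+ 2.
Proof.
rewrite Stab_fourier sum_sets_card_le1 cards0 expr0 mul1r mulr_sumr.
by congr (_ + _ + _); apply: eq_bigr => i _; rewrite cards1 expr1.
Qed.

Lemma parseval n (f : cube n -> bool) :
  fourier R f set0 ^+ 2 + \sum_i fourier R f [set i] ^+ 2 +
    \sum_(S : {set 'I_n} | (2 <= #|S|)%N) fourier R f S ^+ 2 = 1.
Proof.
rewrite -(Stab1 f) Stab_split mul1r; congr (_ + _).
by apply: eq_bigr => S _; rewrite expr1n mul1r.
Qed.

End FourierExpansion.

(** * Sums of n signs and the degree-1 weight of majority *)

Section Walk.
Variable R : realType.
Implicit Types n : nat.

Definition walk n (x : cube n) : R := \sum_(i < n) pm R (x i).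

(** Unnormalized: [absum n] / 2^n is the mean of |x_1 + ... + x_n|, and [zeros n] / 2^n is the
    probability that this sum is 0. *)
Definition absum n : R := \sum_(x : cube n) `|walk x|.

Definition zeros n : R := \sum_(x : cube n) (walk x == 0)%:R.

Lemma cube_cons0 n b (y : cube n) : cube_cons b y ord0 = b.
Proof. by rewrite ffunE unlift_none. Qed.

Lemma cube_consS n b (y : cube n) j : cube_cons b y (lift ord0 j) = y j.
Proof. by rewrite ffunE liftK. Qed.

Lemma walk_cons n b (y : cube n) : walk (cube_cons b y) = pm R b + walk y.
Proof.
rewrite /walk big_ord_recl cube_cons0; congr (_ + _).
by apply: eq_bigr => i _; rewrite cube_consS.
Qed.

Lemma walk_int n (x : cube n) : walk x \is a Num.int.
Proof. by apply: rpred_sum => i _; case: (x i); rewrite /pm ?rpredN rpred1. Qed.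

(** The integrality gap: it turns every later sign question about a sum of signs into linear
    arithmetic. *)
Lemma walk_neq0 n (x : cube n) : walk x != 0 -> walk x <= -1 \/ 1 <= walk x.
Proof.
move=> /(norm_intr_ge1 (walk_int x)); rewrite ler_normr => /orP [|].
  by right.
by left; lra.
Qed.

(** For an integer w, |w + 1| + |w - 1| equals 2|w|, except at w = 0 where it is 2. *)
Lemma absumS n : absum n.+1 = 2 * absum n + 2 * zeros n.
Proof.
rewrite /absum /zeros sum_cube_recl -big_split /= !mulr_sumr -big_split /=.
apply: eq_bigr => y _; rewrite !walk_cons /pm.
have [->|/walk_neq0 [w0|w0]] := eqVneq (walk y) 0.
- by rewrite !addr0 normrN normr1 normr0 /=; lra.
- rewrite !ler0_norm /=; lra.
- rewrite !ger0_norm /=; lra.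
Qed.

Lemma absum0 : absum 0 = 0.
Proof. by rewrite /absum big1 // => x _; rewrite /walk big_ord0 normr0. Qed.

Lemma walk_count n (x : cube n) : walk x = (\sum_i x i)%N%:R * 2 - n%:R.
Proof.
rewrite natr_sum mulr_suml -[X in _ - X%:R]card_ord -sumr_const -sumrB.
by apply: eq_bigr => i _; case: (x i); rewrite /pm /=; ring.
Qed.

(** Splitting off the first coordinate reproduces Pascal's rule. *)
Lemma sum_cube_count n k :
  \sum_(x : cube n) ((\sum_i x i)%N == k)%:R = 'C(n, k)%:R :> R.
Proof.
elim: n k => [|n IH] k.
  under eq_bigr => x _ do rewrite big_ord0.
  by rewrite sumr_const card_ffun card_ord expn0 mulr1n bin0n eq_sym.
have cons_count b (y : cube n) :
    (\sum_i cube_cons b y i = b + \sum_i y i)%N.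
  rewrite big_ord_recl cube_cons0; congr (_ + _)%N.
  by apply: eq_bigr => i _; rewrite cube_consS.
rewrite sum_cube_recl.
under eq_bigr => y _ do rewrite cons_count add1n.
under [X in _ + X]eq_bigr => y _ do rewrite cons_count add0n.
case: k => [|k].
  by rewrite IH big1 // add0r !bin0.
by under eq_bigr => y _ do rewrite eqSS; rewrite !IH binS natrD addrC.
Qed.

Lemma zeros_even j : zeros j.*2 = 'C(j.*2, j)%:R.
Proof.
rewrite -sum_cube_count; apply: eq_bigr => x _; congr ((nat_of_bool _)%:R).
by rewrite walk_count subr_eq0 -natrM eqr_nat muln2 (inj_eq double_inj).
Qed.

Lemma walk_odd n (x : cube n) : odd n -> walk x != 0.
Proof.
move=> on; rewrite walk_count subr_eq0 -natrM eqr_nat muln2.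
by apply: contraTneq on => <-; rewrite odd_double.
Qed.

Lemma zeros_odd n : odd n -> zeros n = 0.
Proof. by move=> on; apply: big1 => x _; rewrite (negbTE (walk_odd x on)). Qed.

(** Two absorption identities, linked through C(2j + 1, j). *)
Lemma central_bin_rec j :
  (j.+1 * 'C(j.+1.*2, j.+1) = 2 * (j.*2.+1 * 'C(j.*2, j)))%N.
Proof.
have e1 := mul_bin_diag j.+1.*2 j; have e2 := mul_bin_down j.*2.+1 j.
by rewrite /= in e1 e2; move: e1 e2; rewrite doubleS /=; nia.
Qed.

Lemma zeros_rec j : j.+1%:R * zeros j.+1.*2 = 2 * j.*2.+1%:R * zeros j.*2.
Proof. by rewrite !zeros_even -mulrA -!natrM central_bin_rec. Qed.

Lemma absum_even j : absum j.*2 = j.*2%:R * zeros j.*2.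
Proof.
elim: j => [|j IH]; first by rewrite double0 absum0 mul0r.
have e := zeros_rec j.
rewrite doubleS !absumS (zeros_odd (n := j.*2.+1)) /= ?odd_double // IH.
rewrite -doubleS.
have -> : j.+1.*2%:R = 2 * j.+1%:R :> R by rewrite -natrM mul2n.
by rewrite -mulrA e -(natr1 j.*2); ring.
Qed.

Lemma fourier1E n (f : cube n -> bool) i :
  fourier R f [set i] = (2 ^+ n)^-1 * \sum_x pm R (f x) * pm R (x i).
Proof. by congr (_ * _); apply: eq_bigr => x _; rewrite /chi big_set1. Qed.

Lemma wsum_tperm n (w : 'I_n -> R) (x : cube n) i j : w i = w j ->
  \sum_k w k * pm R ([ffun k => x (tperm i j k)] k) = \sum_k w k * pm R (x k).
Proof.
move=> wij; rewrite [RHS](reindex_inj (@perm_inj _ (tperm i j))) /=.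
apply: eq_bigr => k _; rewrite ffunE; congr (_ * _).
by case: tpermP => [->|->|].
Qed.

Lemma pm_sgn_mul (z : R) : pm R (sgn z) * z = `|z|.
Proof.
rewrite /sgn /pm; case: (lerP 0 z) => [/ger0_norm ->|/ltr0_norm ->].
  by rewrite mul1r.
by rewrite mulN1r.
Qed.

(** By symmetry the n degree-1 coefficients agree, and they add up to the mean of Maj(x) (x_1 + ...
    + x_n), which is the mean of |x_1 + ... + x_n|. *)
Lemma fourier1_Maj n i :
  fourier R (@Maj R n) [set i] = absum n / (2 ^+ n * n%:R).
Proof.
have sym k : fourier R (@Maj R n) [set k] = fourier R (@Maj R n) [set i].
  apply: fourier_perm => x; congr sgn.
  have := @wsum_tperm n (fun=> 1) x k i erefl.
  by under eq_bigr do rewrite mul1r; under [in RHS]eq_bigr do rewrite mul1r.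
have n0 : n%:R != 0 :> R by case: n i {sym} => [[]|n] // _; rewrite pnatr_eq0.
suff e : n%:R * fourier R (@Maj R n) [set i] = (2 ^+ n)^-1 * absum n.
  by apply: (mulfI n0); rewrite e; field;
    rewrite n0 ?mulr1 expf_neq0 ?pnatr_eq0.
rewrite mulr_natl -[X in _ *+ X]card_ord -sumr_const.
rewrite -(eq_bigr _ (fun k _ => sym k)).
under eq_bigr => k _ do rewrite fourier1E.
rewrite -mulr_sumr exchange_big /=; congr (_ * _); apply: eq_bigr => x _.
by rewrite -mulr_sumr pm_sgn_mul.
Qed.

Lemma sum_fourier1_Maj n : (0 < n)%N ->
  \sum_i fourier R (@Maj R n) [set i] ^+ 2 = (absum n / 2 ^+ n) ^+ 2 / n%:R.
Proof.
move=> n0; under eq_bigr => i _ do rewrite fourier1_Maj.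
have nR0 : n%:R != 0 :> R by rewrite pnatr_eq0 -lt0n.
rewrite sumr_const card_ord -mulr_natl; field.
by rewrite nR0 ?mulr1 expf_neq0 ?pnatr_eq0.
Qed.

Lemma sgnN (z : R) : z != 0 -> sgn (- z) = ~~ sgn z.
Proof. by move=> z0; rewrite /sgn oppr_ge0 -ltNge lt_neqAle z0. Qed.

Lemma Maj_neg n (x : cube n) : odd n -> Maj R (cube_neg x) = ~~ Maj R x.
Proof.
move=> on; rewrite /Maj -(sgnN (walk_odd x on)) -sumrN.
by congr sgn; apply: eq_bigr => i _; rewrite ffunE pmN.
Qed.

End Walk.

(** * The tie-broken majority and its degree-1 weight *)

Section TieBreaking.
Variable R : realType.
Implicit Types m n : nat.

(** The weight 4 exceeds 3, the largest sum of the three tie-breaking bits, so a nonzero integer sum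
    of the other bits always decides. *)
Definition tie_weight m (i : 'I_m.+3) : R := if (i < 3)%N then 1 else 4.

(* The majority of the last [m] bits, ties being broken by the majority of the
   first three. *)
Definition tie3 m (x : cube m.+3) : bool :=
  sgn (\sum_i tie_weight i * pm R (x i)).

Definition cube_cons3 m a b c (y : cube m) : cube m.+3 :=
  cube_cons a (cube_cons b (cube_cons c y)).

Lemma sum_cube_cons3 m (F : cube m.+3 -> R) :
  \sum_x F x = \sum_y
    (F (cube_cons3 true true true y) + F (cube_cons3 true true false y) +
     F (cube_cons3 true false true y) + F (cube_cons3 true false false y) +
     F (cube_cons3 false true true y) + F (cube_cons3 false true false y) +
     F (cube_cons3 false false true y) + F (cube_cons3 false false false y)).
Proof. by rewrite !big_split !sum_cube_recl /=; ring. Qed.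

Lemma tie_wsum_cons m a b c (y : cube m) :
  \sum_i tie_weight i * pm R (cube_cons3 a b c y i) =
  pm R a + pm R b + pm R c + 4 * walk R y.
Proof.
rewrite !big_ord_recl !(cube_cons0, cube_consS) /tie_weight /= !mul1r !addrA.
congr (_ + _); rewrite mulr_sumr; apply: eq_bigr => i _.
by rewrite !cube_consS.
Qed.

Lemma tie3_cons m a b c (y : cube m) :
  tie3 (cube_cons3 a b c y) = sgn (pm R a + pm R b + pm R c + 4 * walk R y).
Proof. by rewrite /tie3 tie_wsum_cons. Qed.

Lemma tie3_is_LTF m : is_LTF R (@tie3 m).
Proof. by exists 0, (@tie_weight m) => x; rewrite add0r. Qed.

Lemma cube_cons3_surj m (x : cube m.+3) :
  exists a b c y, x = cube_cons3 a b c y.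
Proof.
have surj n (z : cube n.+1) : exists b y, z = cube_cons b y.
  exists (z ord0), [ffun j => z (lift ord0 j)]; apply/ffunP=> i.
  by rewrite !ffunE; case: unliftP => [j ->|->]; rewrite ?ffunE.
have [a [x' ->]] := surj _ x; have [b [x'' ->]] := surj _ x'.
by have [c [y ->]] := surj _ x''; exists a, b, c, y.
Qed.

(** In a tie the sum of three signs is odd; otherwise the term 4 [walk] dominates. Thus the
    convention sgn 0 = 1 never interferes with oddness of [tie3]. *)
Lemma tie_wsum_neq0 m (x : cube m.+3) : \sum_i tie_weight i * pm R (x i) != 0.
Proof.
have [a [b [c [y ->]]]] := cube_cons3_surj x.
rewrite tie_wsum_cons.
have [->|/walk_neq0 [w0|w0]] := eqVneq (walk R y) 0;
  by case: a; case: b; case: c; rewrite /pm; apply/eqP => ?; lra.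
Qed.

Lemma tie3_neg m (x : cube m.+3) : tie3 (cube_neg x) = ~~ tie3 x.
Proof.
rewrite /tie3 -(sgnN (tie_wsum_neq0 x)) -sumrN.
by congr sgn; apply: eq_bigr => i _; rewrite ffunE pmN mulrN.
Qed.

(** When the last m bits are not tied, the value ignores the first three bits and the sum over these
    cancels. Each tie contributes the sum of Maj_3(a, b, c) a over the 8 triples, which is 4. *)
Lemma fourier1_tie3_small m (i : 'I_m.+3) : (i < 3)%N ->
  fourier R (@tie3 m) [set i] = zeros R m / (2 * 2 ^+ m).
Proof.
move=> i3.
have wi : tie_weight i = tie_weight (ord0 : 'I_m.+3) by rewrite /tie_weight i3.
have -> : fourier R (@tie3 m) [set i] = fourier R (@tie3 m) [set ord0].
  by apply: fourier_perm => x; congr sgn; apply: wsum_tperm.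
rewrite fourier1E sum_cube_cons3.
have -> : zeros R m / (2 * 2 ^+ m) = (2 ^+ m.+3)^-1 * (4 * zeros R m).
  by rewrite !exprS; field; rewrite expf_neq0 // pnatr_eq0.
congr (_ * _); rewrite /zeros mulr_sumr; apply: eq_bigr => y _.
rewrite !tie3_cons !cube_cons0 /sgn /pm.
have [->|/walk_neq0 [w0|w0]] := eqVneq (walk R y) 0.
- rewrite mulr0 !addr0 /=.
  (* One sign test for each of the 8 triples; [lra] discards the impossible outcomes. *)
  by do 8![case: lerP => ?; try (by exfalso; lra)]; lra.
- by rewrite /=; do 8![case: lerP => ?; try (by exfalso; lra)]; lra.
- by rewrite /=; do 8![case: lerP => ?; try (by exfalso; lra)]; lra.
Qed.

(** The symmetry argument of [fourier1_Maj] on the last m bits: whatever the first three are, the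
    value times [walk] is |[walk]|, ties giving 0 on both sides. *)
Lemma fourier1_tie3_big m (j : 'I_m) :
  fourier R (@tie3 m) [set lift ord0 (lift ord0 (lift ord0 j))] =
  absum R m / (2 ^+ m * m%:R).
Proof.
pose l3 (k : 'I_m) := lift ord0 (lift ord0 (lift ord0 k)).
have sym k : fourier R (@tie3 m) [set l3 k] = fourier R (@tie3 m) [set l3 j].
  by apply: fourier_perm => x; congr sgn; apply: wsum_tperm.
have m0 : m%:R != 0 :> R.
  by case: m j {l3 sym} => [[]|m] // _; rewrite pnatr_eq0.
have p0 : 2 ^+ m != 0 :> R by rewrite expf_neq0 // pnatr_eq0.
suff e : m%:R * fourier R (@tie3 m) [set l3 j] =
    (2 ^+ m.+3)^-1 * (8 * absum R m).
  by apply: (mulfI m0); rewrite e !exprS; field; rewrite m0 ?mulr1 p0.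
rewrite mulr_natl -[X in _ *+ X]card_ord -sumr_const.
rewrite -(eq_bigr _ (fun k _ => sym k)).
under eq_bigr => k _ do rewrite fourier1E.
rewrite -mulr_sumr exchange_big /= sum_cube_cons3; congr (_ * _).
rewrite mulr_sumr; apply: eq_bigr => y _.
have tail a b c :
    \sum_(k < m) pm R (tie3 (cube_cons3 a b c y)) *
      pm R (cube_cons3 a b c y (l3 k))
    = `|walk R y|.
  rewrite -mulr_sumr tie3_cons.
  under eq_bigr => k _ do rewrite !cube_consS.
  rewrite -/(walk R y) /sgn.
  have [->|/walk_neq0 [w0|w0]] := eqVneq (walk R y) 0.
  - by rewrite mulr0 normr0.
  - rewrite ler0_norm /pm; last lra.
    by case: a; case: b; case: c; case: lerP => ?; lra.
  - rewrite ger0_norm /pm; last lra.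
    by case: a; case: b; case: c; case: lerP => ?; lra.
by rewrite !tail; ring.
Qed.

Lemma sum_fourier1_tie3 m : (0 < m)%N ->
  \sum_i fourier R (@tie3 m) [set i] ^+ 2 =
  (absum R m / 2 ^+ m) ^+ 2 / m%:R + 3 / 4 * (zeros R m / 2 ^+ m) ^+ 2.
Proof.
move=> m0; rewrite !big_ord_recl !fourier1_tie3_small //.
under eq_bigr => j _ do rewrite fourier1_tie3_big.
have mR0 : m%:R != 0 :> R by rewrite pnatr_eq0 -lt0n.
have pR0 : 2 ^+ m != 0 :> R by rewrite expf_neq0 // pnatr_eq0.
by rewrite sumr_const card_ord -mulr_natl; field; rewrite mR0 ?mulr1 pR0.
Qed.

Lemma fourier1_tie3_lt_Maj j : (0 < j)%N ->
  \sum_i fourier R (@tie3 j.*2) [set i] ^+ 2 <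
  \sum_i fourier R (@Maj R j.*2.+3) [set i] ^+ 2.
Proof.
move=> j0; rewrite sum_fourier1_tie3 ?double_gt0 // sum_fourier1_Maj //.
(* With m = 2j, the majority is on m + 3 = 2(j + 1) + 1 bits: one [absumS] step reduces it to the
   even case m + 2. *)
rewrite -doubleS (absumS _ j.+1.*2) !absum_even.
have := zeros_rec R j; set z := zeros R j.*2; set z' := zeros R j.+1.*2 => e.
have z0 : 0 < z by rewrite /z zeros_even ltr0n bin_gt0 -addnn leq_addr.
have jR : 1 <= j%:R :> R by rewrite ler1n.
have p0 : 0 < 2 ^+ j.*2 :> R by rewrite exprn_gt0.
have d1 : j.*2%:R = 2 * j%:R :> R by rewrite -natrM mul2n.
have -> : z' = 2 * (2 * j%:R + 1) * z / (j%:R + 1).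
  apply: (mulfI (x := j.+1%:R)); first by rewrite pnatr_eq0.
  by rewrite e -(natr1 j) -(natr1 j.*2) d1; field; rewrite gt_eqF //; lra.
rewrite doubleS -(natr1 j.*2.+2) -(natr1 j.*2.+1) -(natr1 j.*2) d1 !exprS.
set t := j%:R in jR *; set p := 2 ^+ j.*2 in p0 *.
(* Here z / p is the tie probability p_m and t / (t + 1) = m / (m + 2), so the gap between the
   weights is an explicit nonzero square. *)
rewrite -subr_gt0 (_ : _ - _ = (z / p * t / (t + 1) / 2) ^+ 2).
  by rewrite exprn_gt0 // !(mulr_gt0, divr_gt0, invr_gt0) //; lra.
field.
by rewrite (gt_eqF p0) /=; apply/and3P; split; lra.
Qed.

End TieBreaking.

(** * Comparing the stabilities *)

Section LeastStable.
Variable R : realType.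
Implicit Types n : nat.

Lemma fourier_sq_sum_ge0 n (P : pred {set 'I_n}) (f : cube n -> bool) :
  0 <= \sum_(S | P S) fourier R f S ^+ 2.
Proof. by apply: sumr_ge0 => S _; exact: sqr_ge0. Qed.

Lemma Maj_not_least_stable n : odd n -> (5 <= n)%N -> ~ Maj_least_stable R n.
Proof.
move=> on n5 H.
have [j j0 en] : exists2 j, (0 < j)%N & n = j.*2.+3.
  by exists (n - 3)./2; lia.
move: H; rewrite {n on n5}en => H; set f := @tie3 R j.*2.
have lt := fourier1_tie3_lt_Maj R j0; rewrite -/f in lt.
set Wf := \sum_i _ in lt; set WM := \sum_i _ in lt.
have f0 : fourier R f set0 = 0.
  by apply: fourier_odd; [exact: tie3_neg|rewrite cards0].
(* Stab f is at most rho Wf + rho^2 and Stab Maj at least rho WM, so any rho strictly between 0 and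
   WM - Wf gives a contradiction; half the gap is such a value. *)
pose rho : R := (WM - Wf) / 2.
have WM1 : WM <= 1.
  have := parseval R (@Maj R j.*2.+3); rewrite -/WM.
  have := fourier_sq_sum_ge0 (fun S => (2 <= #|S|)%N) (@Maj R j.*2.+3).
  by have := sqr_ge0 (fourier R (@Maj R j.*2.+3) set0); lra.
have Wf0 : 0 <= Wf by apply: sumr_ge0 => i _; exact: sqr_ge0.
have rho0 : 0 < rho by rewrite /rho; lra.
have rho01 : 0 <= rho <= 1 by rewrite /rho; lra.
have := H f (@tie3_is_LTF R j.*2) rho rho01.
rewrite !Stab_split f0 -/Wf -/WM.
set A := \sum_(S : {set _} | _) _; set B := \sum_(S : {set _} | _) _.
have A0 : 0 <= A.
  by apply: sumr_ge0 => S _; rewrite mulr_ge0 ?sqr_ge0 ?exprn_ge0 ?ltW.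
have B1 : B <= rho ^+ 2.
  have : B <= rho ^+ 2 *
      \sum_(S : {set 'I_j.*2.+3} | (2 <= #|S|)%N) fourier R f S ^+ 2.
    rewrite mulr_sumr; apply: ler_sum => S S2; rewrite ler_wpM2r ?sqr_ge0 //.
    by apply: ler_wiXn2l => //; case/andP: rho01.
  move/le_trans; apply; rewrite ler_piMr ?sqr_ge0 //.
  by have := parseval R f; rewrite f0 -/Wf; lra.
have M0 := sqr_ge0 (fourier R (@Maj R j.*2.+3) set0).
have : 2 * rho = WM - Wf by rewrite /rho; lra.
nra.
Qed.

(** Let W be the weight of degree at most 1. Since rho^|S| >= rho^3, Stab f >= rho W + rho^3 (1 -
    W), with equality for Maj_n, whose even coefficients vanish. This bound increases with W because
    rho^3 <= rho. *)
Lemma Maj_le_Stab n (f : cube n -> bool) (rho : R) :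
  odd n -> (n <= 3)%N -> 0 <= rho <= 1 ->
  \sum_i fourier R (@Maj R n) [set i] ^+ 2 <=
    fourier R f set0 ^+ 2 + \sum_i fourier R f [set i] ^+ 2 ->
  Stab rho (@Maj R n) <= Stab rho f.
Proof.
move=> on n3 rho01 le_W; rewrite !Stab_split.
have := parseval R f; have := parseval R (@Maj R n).
have -> : fourier R (@Maj R n) set0 = 0.
  by apply: fourier_odd; [move=> x; exact: Maj_neg|rewrite cards0].
have card3 (S : {set 'I_n}) : (#|S| <= 3)%N.
  by apply: leq_trans n3; rewrite -[X in (_ <= X)%N]card_ord max_card.
have -> : \sum_(S : {set 'I_n} | (2 <= #|S|)%N)
      rho ^+ #|S| * fourier R (@Maj R n) S ^+ 2 =
    rho ^+ 3 *
      \sum_(S : {set 'I_n} | (2 <= #|S|)%N) fourier R (@Maj R n) S ^+ 2.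
  rewrite mulr_sumr; apply: eq_bigr => S S2.
  have [oS|eS] := boolP (odd #|S|).
    by have -> : #|S| = 3 by move: oS S2 (card3 S); lia.
  rewrite fourier_odd ?expr0n ?mulr0 //.
  by move=> x; exact: Maj_neg.
have : rho ^+ 3 * \sum_(S : {set 'I_n} | (2 <= #|S|)%N) fourier R f S ^+ 2 <=
    \sum_(S : {set 'I_n} | (2 <= #|S|)%N) rho ^+ #|S| * fourier R f S ^+ 2.
  rewrite mulr_sumr; apply: ler_sum => S _; rewrite ler_wpM2r ?sqr_ge0 //.
  by case/andP: rho01 => r0 r1; exact: ler_wiXn2l.
have := sqr_ge0 (fourier R f set0).
move: le_W.
set a := fourier _ _ _ ^+ 2; set b := \sum_i _; set b' := \sum_i _.
set c := \sum_(S | _) _; set c' := \sum_(S | _) _; set c'' := \sum_(S | _) _.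
case/andP: rho01 => r0 r1.
have r3 : rho ^+ 3 <= rho by rewrite -[leRHS]expr1; exact: ler_wiXn2l.
rewrite expr0n /=; move: (rho ^+ 3) r3 => q r3.
nra.
Qed.

(** Otherwise one of the two equal sums would be nonnegative and the other negative. *)
Lemma sgn_asummable (s t u v : R) : s + t = u + v ->
  ~~ [&& sgn s == sgn t, sgn u == sgn v & sgn s != sgn u].
Proof.
rewrite /sgn => e.
by case: (lerP 0 s) => ?; case: (lerP 0 t) => ?; case: (lerP 0 u) => ?;
  case: (lerP 0 v) => ? //=; exfalso; lra.
Qed.

(** The bound 3/4 is the degree-1 weight of Maj_3, whose three coefficients are 1/2. *)
Lemma LTF3_weight (f : cube 3 -> bool) : is_LTF R f ->
  3 / 4 <= fourier R f set0 ^+ 2 + \sum_i fourier R f [set i] ^+ 2.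
Proof.
case=> w0 [w fE].
pose y0 : cube 0 := [ffun=> false].
pose g a b c := f (cube_cons3 a b c y0).
have gE a b c : g a b c = sgn (w0 + (w ord0 * pm R a +
    (w (lift ord0 ord0) * pm R b + w (lift ord0 (lift ord0 ord0)) * pm R c))).
  by rewrite /g fE !big_ord_recl big_ord0 !(cube_cons0, cube_consS) addr0.
have pmD (a a' : bool) : pm R a + pm R a' = 2 * (a + a')%N%:R - 2.
  by case: a; case: a'; rewrite /pm /=; lra.
(* Two pairs of vertices with the same sum give the same sum of the affine form. Counting in [nat]
   lets [erefl] check each instance. *)
have asum (a b c a' b' c' a1 b1 c1 a1' b1' c1' : bool) :
    (a + a' = a1 + a1')%N -> (b + b' = b1 + b1')%N -> (c + c' = c1 + c1')%N ->
    ~~ [&& g a b c == g a' b' c', g a1 b1 c1 == g a1' b1' c1' &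
           g a b c != g a1 b1 c1].
  move=> /(congr1 (fun k => 2 * k%:R - 2 : R)); rewrite -!pmD => ea.
  move=> /(congr1 (fun k => 2 * k%:R - 2 : R)); rewrite -!pmD => eb.
  move=> /(congr1 (fun k => 2 * k%:R - 2 : R)); rewrite -!pmD => ec.
  rewrite !gE; apply: sgn_asummable.
  transitivity (2 * w0 + w ord0 * (pm R a + pm R a') +
    w (lift ord0 ord0) * (pm R b + pm R b') +
    w (lift ord0 (lift ord0 ord0)) * (pm R c + pm R c')); first by ring.
  by rewrite ea eb ec; ring.
have sum_f (h : cube 3 -> R) : \sum_x pm R (f x) * h x =
    let F a b c := pm R (g a b c) * h (cube_cons3 a b c y0) in
    F true true true + F true true false + F true false true +
    F true false false + F false true true + F false true false +
    F false false true + F false false false.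
  rewrite sum_cube_cons3 (bigD1 y0) //= big1 ?addr0 // => y /eqP [].
  by apply/ffunP=> -[].
rewrite !big_ord_recl big_ord0 !fourier1E /fourier !sum_f /=.
rewrite /chi !big_set0 !(cube_cons0, cube_consS).
(* All nontrivial relations: the two diagonals of each of the six faces, then the six pairs among
   the four main diagonals. *)
have := asum true true true true false false true true false true false true
  erefl erefl erefl.
have := asum false true true false false false false true false false false true
  erefl erefl erefl.
have := asum true true true false true false true true false false true true
  erefl erefl erefl.
have := asum true false true false false false true false false false false true
  erefl erefl erefl.
have := asum true true true false false true true false true false true true
  erefl erefl erefl.
have := asum true true false false false false true false false false true false
  erefl erefl erefl.
have := asum true true true false false false true true false false false true
  erefl erefl erefl.
have := asum true true true false false false true false true false true false
  erefl erefl erefl.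
have := asum true true true false false false true false false false true true
  erefl erefl erefl.
have := asum true true false false false true true false true false true false
  erefl erefl erefl.
have := asum true true false false false true true false false false true true
  erefl erefl erefl.
have := asum true false true false true false true false false false true true
  erefl erefl erefl.
move: (g true true true) (g true true false) (g true false true)
  (g true false false) (g false true true) (g false true false)
  (g false false true) (g false false false) => {sum_f asum gE fE}.
rewrite /pm.
(* Of the 256 truth tables, those breaking a relation have an absurd hypothesis; for the others the
   weight is a number. *)
case; case; case; case; case; case; case; case; try done; move=> *; lra.
Qed.
End LeastStable.

Local Close Scope ring_scope.

Theorem theorem2 (R : realType) :
  Maj_least_stable R 1 /\ Maj_least_stable R 3 /\
  (forall n : nat, odd n -> 5 <= n -> ~ Maj_least_stable R n).
Proof.
split; last split; last exact: Maj_not_least_stable.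
- move=> f _ rho rho01; apply: Maj_le_Stab => //.
  (* For n = 1 no set has two elements, so by Parseval every f has weight 1 in degrees 0 and 1. *)
  have no_big (h : cube 1 -> bool) :
      (\sum_(S : {set 'I_1} | (2 <= #|S|)%N) fourier R h S ^+ 2 = 0)%R.
    apply: big_pred0 => S.
    by rewrite ltnNge -[X in _ <= X](card_ord 1) max_card.
  have := parseval R f; have := parseval R (@Maj R 1).
  by rewrite !no_big !addr0 => <- ->; rewrite lerDr sqr_ge0.
- move=> f ltf rho rho01; apply: Maj_le_Stab => //.
  apply: le_trans (LTF3_weight ltf).
  (* For n = 3 the mean of |x_1 + x_2 + x_3| is 12/8, so the weight is (3/2)^2 / 3 = 3/4. *)
  rewrite sum_fourier1_Maj // (absumS R 1.*2) absum_even zeros_even.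
  by rewrite (_ : 'C(1.*2, 1) = 2) //= -[1.*2]/2; lra.
Qed.
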